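(* Consider a cable without discrete loads moving at steady speed $v$, with tension $T>0$ and mass per unit length $\rho>0$, $a=\sqrt{T/\rho}$, $0\le v<a$, on an interval of integration $[0,l(t)]$ whose length $l(t)>0$ changes with a constant velocity for $t_0\le t\le t_1$. Let $\omega_k(t)$, $k=1,2,\dots$, be its natural frequencies at time $t$, given by the formulas in the context, either with the Coriolis acceleration taken into account or with it neglected. Then, in both cases: (i) the speed $v$ of the cable motion decreases the frequencies of vibrations: for given $\rho$, $T$ and given length $l(t)$ of the interval, each $\omega_k(t)$ is a decreasing function of $v\in[0,a)$; (ii) the decrease of the integration interval, under the condition of invariance of the initial tension, always increases the frequencies: for fixed $T$, $\rho$ and $v$, each $\omega_k(t)$ increases when the length $l(t)$ decreases.
   Context: The motion of the cable without discrete loads is described by $$\rho\Big(\frac{\partial^2u}{\partial t^2}+2v\frac{\partial^2u}{\partial x\partial t}+v^2\frac{\partial^2u}{\partial x^2}\Big)=T\frac{\partial^2u}{\partial x^2},$$ with $u=0$ at both ends of the interval of integration; the term with $\frac{\partial^2u}{\partial x\partial t}$ is the Coriolis acceleration. When the interval of integration $[0,l(t)]$ changes with a constant velocity ($l(t)$ is an affine function of $t$), the natural frequencies at time $t\in[t_0,t_1]$ are determined, for $k=1,2,\dots$ and $a>v$, by $$\omega_k(t)=\frac{\pi k}{l(t)}\,\frac{a^2-v^2}{a}$$ when the Coriolis acceleration is taken into account, and by $$\omega_k(t)=\frac{\pi k}{l(t)}\sqrt{a^2-v^2}$$ when the Coriolis acceleration is neglected. *)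

(* Defs.v *)
From HB Require Import structures.
From mathcomp Require Import all_boot all_order all_algebra.
From mathcomp Require Import all_classical all_reals all_analysis.

Set Implicit Arguments.
Unset Strict Implicit.
Unset Printing Implicit Defensive.

Import Order.TTheory GRing.Theory Num.Theory.
Local Open Scope ring_scope.

Definition wave_speed (R : realType) (rho T : R) : R := Num.sqrt (T / rho).

Inductive coriolis_model := CoriolisIncluded | CoriolisNeglected.

(* The [k]-th natural frequency, [k = 1, 2, ...], of a cable moving at speed
   [v], when the interval of integration has current length [L].  The formulas
   are meaningful for [0 <= v < wave_speed rho T], [0 < L] and [0 < k]. *)
Definition natural_frequency (R : realType) (m : coriolis_model)
    (rho T v L : R) (k : nat) : R :=
  let a := wave_speed rho T in
  match m with
  | CoriolisIncluded => pi * k%:R / L * ((a ^+ 2 - v ^+ 2) / a)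
  | CoriolisNeglected => pi * k%:R / L * Num.sqrt (a ^+ 2 - v ^+ 2)
  end.

(* The constant velocity [c] may have either sign. *)
Definition changes_at_constant_velocity (R : realType) (t0 t1 : R)
    (l : R -> R) : Prop :=
  exists c : R, forall t : R, t0 <= t <= t1 -> l t = l t0 + c * (t - t0).

(* Main.v *)
Require Import Defs.
From HB Require Import structures.
From mathcomp Require Import all_boot all_order all_algebra.
From mathcomp Require Import all_classical all_reals all_analysis.

Set Implicit Arguments.
Unset Strict Implicit.
Unset Printing Implicit Defensive.

Import Order.TTheory GRing.Theory Num.Theory.
Local Open Scope ring_scope.

(** Both frequency formulas have the shape [pi * k / L * g v], where the
geometric factor [pi * k / L] depends only on the mode and the length, and the
speed factor [g v], equal to [(a^2 - v^2) / a] or [sqrt (a^2 - v^2)], depends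
only on the speed.  On [0 <= v < a] the square [v^2] increases and stays below
[a^2], so [g] is positive and strictly decreasing ([speed_factor_gt0],
[speed_factor_lt]), while the geometric factor is positive and strictly
decreasing in [L] ([mode_factor_lt]).  Each claim varies one factor and keeps
the other, positive, one fixed.  The two Coriolis models enter only through
these two properties of [g]. *)

Definition speed_factor (R : realType) (m : coriolis_model) (a v : R) : R :=
  match m with
  | CoriolisIncluded => (a ^+ 2 - v ^+ 2) / a
  | CoriolisNeglected => Num.sqrt (a ^+ 2 - v ^+ 2)
  end.

Lemma natural_frequencyE (R : realType) (m : coriolis_model) (rho T v L : R)
    (k : nat) :
  natural_frequency m rho T v L k =
  pi * k%:R / L * speed_factor m (wave_speed rho T) v.
Proof. by case: m. Qed.

Lemma sqr_lt_sqr (R : realType) (v w : R) : 0 <= v -> v < w -> v ^+ 2 < w ^+ 2.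
Proof.
move=> v0 vw; have w0 : 0 <= w := le_trans v0 (ltW vw).
by rewrite ltr_pXn2r // nnegrE.
Qed.

Lemma speed_factor_gt0 (R : realType) (m : coriolis_model) (a v : R) :
  0 <= v -> v < a -> 0 < speed_factor m a v.
Proof.
move=> v0 va; have a0 : 0 < a := le_lt_trans v0 va.
have d0 : 0 < a ^+ 2 - v ^+ 2 by rewrite subr_gt0 sqr_lt_sqr.
by case: m; rewrite /= ?sqrtr_gt0 ?divr_gt0.
Qed.

(** Both [d / a], for [a > 0], and [sqrt d], for [d > 0], are strictly
increasing in [d = a^2 - v^2].  The square root is constant on nonpositive
arguments, which the bound [w < a] excludes. *)
Lemma speed_factor_lt (R : realType) (m : coriolis_model) (a v w : R) :
  0 <= v -> v < w -> w < a -> speed_factor m a w < speed_factor m a v.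
Proof.
move=> v0 vw wa; have va := lt_trans vw wa.
have a0 : 0 < a := le_lt_trans v0 va.
have dlt : a ^+ 2 - w ^+ 2 < a ^+ 2 - v ^+ 2.
  by rewrite ltrD2l ltrN2 sqr_lt_sqr.
have d0 : 0 < a ^+ 2 - v ^+ 2 by rewrite subr_gt0 sqr_lt_sqr.
by case: m; rewrite /= ?ltr_sqrt // ltr_pM2r ?invr_gt0.
Qed.

Lemma mode_factor_gt0 (R : realType) (L : R) (k : nat) :
  (0 < k)%N -> 0 < L -> 0 < pi * k%:R / L.
Proof. by move=> k0 L0; rewrite divr_gt0 ?mulr_gt0 ?pi_gt0 ?ltr0n. Qed.

Lemma mode_factor_lt (R : realType) (L L' : R) (k : nat) :
  (0 < k)%N -> 0 < L' -> L' < L -> pi * k%:R / L < pi * k%:R / L'.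
Proof.
move=> k0 L'0 L'L; have L0 := lt_trans L'0 L'L.
by rewrite ltr_pM2l ?ltf_pV2 ?posrE ?mulr_gt0 ?pi_gt0 ?ltr0n.
Qed.

Lemma natural_frequency_lt_speed (R : realType) (m : coriolis_model)
    (rho T v w L : R) (k : nat) :
  (0 < k)%N -> 0 < L -> 0 <= v -> v < w -> w < wave_speed rho T ->
  natural_frequency m rho T w L k < natural_frequency m rho T v L k.
Proof.
move=> k0 L0 v0 vw wa; rewrite !natural_frequencyE.
by rewrite ltr_pM2l ?speed_factor_lt ?mode_factor_gt0.
Qed.

Lemma natural_frequency_lt_length (R : realType) (m : coriolis_model)
    (rho T v L L' : R) (k : nat) :
  (0 < k)%N -> 0 <= v < wave_speed rho T -> 0 < L' -> L' < L ->
  natural_frequency m rho T v L k < natural_frequency m rho T v L' k.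
Proof.
move=> k0 /andP[v0 va] L'0 L'L; rewrite !natural_frequencyE.
by rewrite ltr_pM2r ?speed_factor_gt0 ?mode_factor_lt.
Qed.

Theorem theorem5 (R : realType) (m : coriolis_model) (rho T t0 t1 : R)
    (l : R -> R) (k : nat)
    (hrho : 0 < rho) (hT : 0 < T) (ht : t0 <= t1)
    (hlc : changes_at_constant_velocity t0 t1 l)
    (hl : forall t : R, t0 <= t <= t1 -> 0 < l t)
    (hk : (0 < k)%N) :
  (forall t : R, t0 <= t <= t1 ->
     forall v w : R, 0 <= v -> v < w -> w < wave_speed rho T ->
       natural_frequency m rho T w (l t) k < natural_frequency m rho T v (l t) k)
  /\
  (forall v : R, 0 <= v < wave_speed rho T ->
     (forall L L' : R, 0 < L' -> L' < L ->
        natural_frequency m rho T v L k < natural_frequency m rho T v L' k)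
     /\
     (forall s t : R, t0 <= s <= t1 -> t0 <= t <= t1 -> l t < l s ->
        natural_frequency m rho T v (l s) k < natural_frequency m rho T v (l t) k)).
Proof.
split=> [t tI v w v0 vw wa | v vI].
  exact: natural_frequency_lt_speed hk (hl t tI) v0 vw wa.
split=> [L L' L'0 L'L | s t _ tI lts].
  exact: natural_frequency_lt_length.
exact: natural_frequency_lt_length hk vI (hl t tI) lts.
Qed.
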